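(* Let $m$ be a positive integer and let $f:[0,1]\to\mathbb{R}$ be a function that has a continuous $(2m-1)$-st derivative on $[0,1]$. If $f^{(2m-1)}$ is decreasing on $[0,1]$, then for every positive integer $p$ we have $$\int_0^1f(t)\,dt=\mathcal{T}_p(f)-\sum_{k=1}^{m-1}\frac{b_{2k}}{(2k)!\,p^{2k}}\left(f^{(2k-1)}(1)-f^{(2k-1)}(0)\right)+(-1)^{m+1}R_{m,p}$$ with $$0\le R_{m,p}\le\frac{6}{(2\pi p)^{2m}}\left(f^{(2m-1)}(0)-f^{(2m-1)}(1)\right).$$
   Context: The Bernoulli polynomials $(B_n)_{n\ge 0}$ are the unique sequence of real polynomials with $B_0(X)=1$ and, for all $n\ge1$, $B_n(X+1)-B_n(X)=nX^{n-1}$ and $\int_0^1B_n(t)\,dt=0$; the Bernoulli numbers are $b_n=B_n(0)$. The trapezoidal rule is $$\mathcal{T}_p(f)=\frac{f(0)+f(1)}{2p}+\frac1p\sum_{k=1}^{p-1}f\left(\frac kp\right).$$ Empty sums are $0$. *)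

(* Defs.v *)
From mathcomp Require Import all_boot all_order all_algebra.
From mathcomp Require Import all_classical all_reals all_analysis.

Set Implicit Arguments.
Unset Strict Implicit.
Unset Printing Implicit Defensive.

Import Order.TTheory GRing.Theory Num.Theory.
Import numFieldNormedType.Exports.

Local Open Scope classical_set_scope.
Local Open Scope ring_scope.

(* Differentiation relative to a set A: the difference quotient is taken along
   points of A only, so the derivative is one-sided at an endpoint of an
   interval, and at a point of A it does not depend on f outside A. *)
Definition derivable_on {R : realType} (A : set R) (f : R -> R) (x : R) : Prop :=
  cvg ((f y - f x) / (y - x) @[y --> within A x^']).

Definition derive_on {R : realType} (A : set R) (f : R -> R) (x : R) : R :=
  lim ((f y - f x) / (y - x) @[y --> within A x^']).

Definition derive_on_n {R : realType} (A : set R) (n : nat) (f : R -> R) :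
    R -> R :=
  iter n (derive_on A) f.

Definition continuous_nth_derive_on {R : realType} (A : set R) (n : nat)
    (f : R -> R) : Prop :=
  (forall k, (k < n)%N -> forall x, A x ->
     derivable_on A (derive_on_n A k f) x) /\
  {within A, continuous (derive_on_n A n f)}.

Definition bernoulli_polys {R : realType} (B : nat -> {poly R}) : Prop :=
  B 0%N = 1 /\
  forall n, (0 < n)%N ->
    B n \Po ('X + 1) - B n = n%:R *: 'X^(n.-1) /\
    \int[lebesgue_measure]_(t in `[0, 1]) (B n).[t] = 0.

Definition trapezoid {R : realType} (p : nat) (f : R -> R) : R :=
  (f 0 + f 1) / (2 * p%:R) + p%:R^-1 * \sum_(1 <= k < p) f (k%:R / p%:R).

Section BernoulliPolynomials.
Context {R : realType}.
Implicit Types (P Q : {poly R}).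

Lemma Rintegral_deriv_poly P :
  \int[lebesgue_measure]_(t in `[0, 1]) P^`().[t] = P.[1] - P.[0].
Proof.
rewrite /Rintegral (@continuous_FTC2 _ _ (horner P)) //.
- by apply/continuous_subspaceT => x; exact: continuous_horner.
- split=> [x _| |]; first exact: derivable_horner.
  + by apply: cvg_at_right_filter; exact: continuous_horner.
  + by apply: cvg_at_left_filter; exact: continuous_horner.
- by move=> x _; rewrite -derivE.
Qed.

Definition antideriv P : {poly R} :=
  \poly_(i < (size P).+1) (P`_i.-1 / i%:R).

Lemma antiderivK P : (antideriv P)^`() = P.
Proof.
apply/polyP => i; rewrite coef_deriv coef_poly ltnS /=.
case: ltnP => h; last by rewrite mul0rn nth_default.
by rewrite -[LHS]mulr_natr mulfVK // pnatr_eq0.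
Qed.

Lemma deriv_eq0_poly P : P^`() = 0 -> P = P.[0]%:P.
Proof.
move=> h; apply/polyP => -[|i]; rewrite coefC /= ?horner_coef0 //.
move/polyP: h => /(_ i); rewrite coef_deriv coef0 => /eqP.
by rewrite mulrn_eq0 /= => /eqP.
Qed.

Fixpoint bernoulli_poly n : {poly R} :=
  if n is n'.+1 then
    let P := n%:R *: antideriv (bernoulli_poly n') in
    P - ((antideriv P).[1] - (antideriv P).[0])%:P
  else 1.

Lemma deriv_bernoulli_poly n :
  (bernoulli_poly n.+1)^`() = n.+1%:R *: bernoulli_poly n.
Proof. by rewrite /= derivB derivC subr0 derivZ antiderivK. Qed.

Lemma Rintegral_polyBC P c :
  \int[lebesgue_measure]_(t in `[0, 1]) (P - c%:P).[t] =
  (antideriv P).[1] - (antideriv P).[0] - c.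
Proof.
have <- : (antideriv P - c *: 'X)^`() = P - c%:P.
  by rewrite derivB derivZ derivX antiderivK alg_polyC.
by rewrite Rintegral_deriv_poly !hornerE subr0 addrAC.
Qed.

Lemma Rintegral_bernoulli_poly n :
  \int[lebesgue_measure]_(t in `[0, 1]) (bernoulli_poly n.+1).[t] = 0.
Proof. by rewrite Rintegral_polyBC subrr. Qed.

Lemma bernoulli_polysP : bernoulli_polys bernoulli_poly.
Proof.
split=> // n n0; split; last first.
  by case: n n0 => // n _; exact: Rintegral_bernoulli_poly.
elim: n n0 => [//|n IH] _; apply/eqP; rewrite -subr_eq0; apply/eqP.
rewrite [n.+1.-1]/=.
set D := (X in X = 0).
suff [D' D0] : D^`() = 0 /\ D.[0] = 0 by rewrite (deriv_eq0_poly D') D0.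
have XS : ('X + 1 : {poly R})^`() = 1 by rewrite derivD derivX derivC addr0.
split.
  rewrite /D 2!derivB deriv_comp !deriv_bernoulli_poly derivZ derivXn XS mulr1.
  rewrite comp_polyZ -scalerBr.
  case: n IH {D} => [|n] IH.
    by rewrite /= comp_polyC subrr mulr0n !scaler0 subrr.
  by rewrite IH // scaler_nat -scalerBr subrr scaler0.
have X1 : ('X + 1 : {poly R}).[0] = 1 by rewrite hornerD hornerX hornerC add0r.
rewrite /D hornerD hornerN hornerD hornerN horner_comp X1 hornerZ hornerXn.
rewrite -Rintegral_deriv_poly.
rewrite deriv_bernoulli_poly.
case: n IH {D} => [|n] IH.
  have -> : 1%:R *: bernoulli_poly 0 = ('X : {poly R})^`() by rewrite scale1r derivX.
  by rewrite Rintegral_deriv_poly !hornerX subr0 expr0 mulr1 subrr.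
rewrite expr0n mulr0 subr0.
have -> : n.+2%:R *: bernoulli_poly n.+1 =
    (n.+2%:R *: antideriv (bernoulli_poly n.+1))^`().
  by rewrite derivZ antiderivK.
rewrite Rintegral_deriv_poly !hornerZ -mulrBr -Rintegral_deriv_poly antiderivK.
by rewrite Rintegral_bernoulli_poly mulr0.
Qed.

Lemma periodic_poly P : P \Po ('X + 1) = P -> P = P.[0]%:P.
Proof.
move=> per.
have Pn n : P.[n%:R] = P.[0].
  elim: n => // n <-; rewrite -[in RHS]per horner_comp !hornerE.
  by rewrite natr1.
apply/eqP; rewrite -subr_eq0; apply/eqP; set Q := P - _.
apply: (@roots_geq_poly_eq0 _ Q [seq n%:R | n <- iota 0 (size Q)]).
- by apply/allP => _ /mapP[n _ ->]; rewrite rootE !hornerE Pn subrr.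
- rewrite map_inj_uniq ?iota_uniq // => i j /eqP.
  by rewrite eqr_nat => /eqP.
- by rewrite size_map size_iota.
Qed.

Lemma bernoulli_polys_unique B : bernoulli_polys B -> B =1 bernoulli_poly.
Proof.
move=> [B0 hB] [|n]; first exact: B0.
have [/eqP + B2] := hB n.+1 isT.
have [_ /(_ n.+1 isT)[/eqP + b2]] := bernoulli_polysP.
rewrite !subr_eq => /eqP b1 /eqP B1.
set c := (bernoulli_poly n.+1 - B n.+1).[0].
have E : bernoulli_poly n.+1 - c%:P = B n.+1.
  rewrite /c -periodic_poly ?subKr // comp_polyB B1 b1.
  by rewrite opprD addrACA subrr add0r.
suff c0 : c = 0 by rewrite -E c0 subr0.
apply: oppr_inj; rewrite oppr0 -B2 -E Rintegral_polyBC.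
by rewrite -Rintegral_deriv_poly antiderivK b2 sub0r.
Qed.

End BernoulliPolynomials.

(* Main.v *)
Require Import Defs.
From mathcomp Require Import all_boot all_order all_algebra.
From mathcomp Require Import all_classical all_reals all_analysis.
From mathcomp Require Import ring lra.

Import Order.TTheory GRing.Theory Num.Theory.
Import numFieldNormedType.Exports.

Local Open Scope classical_set_scope.
Local Open Scope ring_scope.

(** Put [b_n = B_n / n!] and [n = 2m - 1]. On a panel [[a, a + d]] with
    [d = 1/p], the function
    [W(t) = \sum_(j < n) (-1)^j d^(j+1) b_(j+1)((t-a)/d) f^(j)(t)]
    has derivative [f(t) + d^n b_n((t-a)/d) f^(n)(t)], so its increment is the
    integral of [f] plus an integral of [b_n] against [f^(n)]. The polynomial
    [(-1)^m b_n] is antisymmetric about 1/2 and nonnegative on [[0, 1/2]]; since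
    [f^(n)] is decreasing, the remainder of the panel, up to its sign, lies
    between 0 and [d^(2m) (f^(n)(a) - f^(n)(a+d))] times
    [I_m = \int_0^(1/2) (-1)^m b_(2m-1)], and the bounds telescope over the
    panels. Only [f^(n)] is available, so these estimates compare increments
    of primitives instead of integrating by parts once more.

    That [I_m <= (pi^2/2) / (2 pi)^(2m)] needs no Fourier series: the polynomials
    [s_m(t) = (-1)^m (b_(2m-1)(t) - b_(2m-1)(t + 1/2))] satisfy
    [s_(m+1)'' = - s_m] where [s_(m+1)] vanishes at 0 and 1/2, so from [m = 2]
    on a bound by a multiple of [sin (2 pi t)], an eigenfunction of this boundary
    problem for the eigenvalue [4 pi^2], improves by the factor [1 / (4 pi^2)] at
    each step.
    Finally [pi^2 <= 12]. *)

(** * Monotonicity and concavity tests; derivatives relative to an interval *)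

Section Calculus.
Context {R : realType}.
Implicit Types (f F : R -> R) (a b x : R).

(** Derivatives are asked for inside the interval only, with continuity up to the ends: this is what
    differentiation relative to [[0, 1]] provides. *)
Lemma is_derive_ge0_le F f a b : a <= b ->
  (forall x, a < x < b -> is_derive x 1 F (f x)) ->
  {within `[a, b], continuous F} ->
  (forall x, a < x < b -> 0 <= f x) -> F a <= F b.
Proof.
rewrite le_eqVlt => /predU1P[->//|ab] dF cF f0.
have dF' x : x \in `]a, b[ -> is_derive x 1 F (f x) by rewrite in_itv; exact: dF.
have [x] := MVT ab dF' cF.
rewrite in_itv /= => /f0 fx E.
by rewrite -subr_ge0 E mulr_ge0 // subr_ge0 ltW.
Qed.

Lemma is_derive_within_continuous F f (A : set R) :
  (forall x, is_derive x 1 F (f x)) -> {within A, continuous F}.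
Proof.
move=> dF; apply: continuous_subspaceT => x.
by apply/differentiable_continuous/derivable1_diffP; exact: ex_derive.
Qed.

(** A negative value at [x] would give, by the mean value theorem on either side, a negative slope
    before [x] and a positive one after it, although [f] decreases. *)
Lemma concave_ge0 F f g b :
  (forall x, is_derive x 1 F (f x)) -> (forall x, is_derive x 1 f (g x)) ->
  F 0 = 0 -> F b = 0 -> (forall x, 0 < x < b -> g x <= 0) ->
  forall x, 0 <= x <= b -> 0 <= F x.
Proof.
move=> dF df F0 Fb g0 x /andP[]; rewrite le_eqVlt => /predU1P[<-|x0].
  by rewrite F0.
rewrite le_eqVlt => /predU1P[->|xb]; first by rewrite Fb.
have cF A := is_derive_within_continuous _ _ A dF.
have cf A := is_derive_within_continuous _ _ A df.
have [y yx Ey] := MVT x0 (fun z _ => dF z) (cF _).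
have [z xz Ez] := MVT xb (fun z _ => dF z) (cF _).
move: yx xz; rewrite !in_itv /= => /andP[y0 yx] /andP[xz zb].
have fzy : - f y <= - f z.
  apply: (@is_derive_ge0_le (fun t => - f t) (fun t => - g t)) => [||t tyz].
  - by rewrite ltW // (lt_trans yx).
  - by apply: (is_derive_within_continuous _ (fun t => - g t)) => t; exact: is_deriveN.
  - by rewrite oppr_ge0 g0 //; lra.
rewrite leNgt; apply/negP => Fx0.
have fy : f y < 0 by rewrite -(pmulr_llt0 _ x0) -[x]subr0 -Ey; lra.
have fz : 0 < f z.
  have xb' : 0 < b - x by lra.
  by rewrite -(pmulr_lgt0 _ xb') -Ez; lra.
lra.
Qed.

Lemma derivable_onP (A : set R) f x : derivable_on A f x ->
  (f y - f x) / (y - x) @[y --> within A x^'] --> derive_on A f x.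
Proof. exact. Qed.

(** Away from [x], [f y - f x] is the convergent difference quotient times [y - x], which tends to
    0. *)
Lemma derivable_on_continuous (A : set R) f :
  (forall x, A x -> derivable_on A f x) -> {within A, continuous f}.
Proof.
move=> df; apply/subspace_continuousP => x /df/derivable_onP dfx.
have yx : y - x @[y --> within A x^'] --> x - x.
  apply: cvgB; last exact: cvg_cst.
  by apply: cvg_within_filter; apply: cvg_within_filter; exact: cvg_id.
have fyx0 : (f y - f x) / (y - x) * (y - x) @[y --> within A x^'] --> (0 : R).
  by rewrite -(mulr0 (derive_on A f x)) -(subrr x); exact: cvgM.
have FA : Filter (within A x^') by exact: within_filter.
move/cvgrPdist_lt : fyx0 => fyx.
apply/cvgrPdist_lt => e e0; have := fyx e e0.
rewrite !near_withinE => fe; near=> y => Ay.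
have [->|nyx] := eqVneq y x; first by rewrite subrr normr0.
have : y != x -> A y -> `|0 - (f y - f x) / (y - x) * (y - x)| < e by near: y.
by rewrite divfK ?subr_eq0 // sub0r opprB; exact.
Unshelve. all: by end_near. Qed.

Lemma derivable_on_is_derive a b f x : a < x < b ->
  derivable_on `[a, b] f x -> is_derive x 1 f (derive_on `[a, b] f x).
Proof.
move=> xab /derivable_onP dfx; set l := derive_on _ _ _ in dfx *.
apply/is_derive1_caratheodory.
(* The slope function of Caratheodory's criterion, completed at [x] by the limit. Since [x] is
   interior, all nearby points lie in [[a, b]]. *)
exists (fun y => if y == x then l else (f y - f x) / (y - x)); split.
- by move=> z; case: eqVneq => [->|zx]; rewrite ?subrr ?mulr0 // divfK ?subr_eq0.
- apply/continuous_withinNx; rewrite eqxx.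
  have FA : Filter (within `[a, b]%classic x^') by exact: within_filter.
  move/cvgrPdist_lt : dfx => dfx; apply/cvgrPdist_lt => e e0.
  have := dfx e e0; rewrite !near_withinE => fe; near=> y => yx.
  rewrite (negbTE yx).
  have : y != x -> `[a, b]%classic y -> `|l - (f y - f x) / (y - x)| < e.
    by near: y.
  apply=> //; apply: subset_itv_oo_cc.
  by near: y; apply: near_in_itvoo; rewrite in_itv.
- by rewrite eqxx.
Unshelve. all: by end_near. Qed.

End Calculus.

(** * Estimates for sine, cosine and pi *)

Section Trigonometric.
Context {R : realType}.
Implicit Types (F f : R -> R) (x t : R).

(** Each Taylor bound below follows from the one before, starting with [cos t <= 1]: the difference
    of its two sides vanishes at 0 and has the previous difference as derivative. *)
Lemma is_derive_nonneg F f x : F 0 = 0 -> (forall t, is_derive t 1 F (f t)) ->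
  (forall t, 0 <= t -> 0 <= f t) -> 0 <= x -> 0 <= F x.
Proof.
move=> F0 dF f0 x0; rewrite -F0; apply: (is_derive_ge0_le F f _ _ x0).
- exact: is_derive_within_continuous dF.
- by move=> t /andP[t0 _]; exact/f0/ltW.
Qed.

Lemma sin_le_id x : 0 <= x -> sin x <= x.
Proof.
move=> x0; rewrite -subr_ge0.
apply: (@is_derive_nonneg (fun t => t - sin t) (fun t => 1 - cos t)) => //.
by rewrite sin0 subrr.
Qed.

Lemma cos_ge_taylor2 x : 0 <= x -> 1 - x ^+ 2 / 2 <= cos x.
Proof.
move=> x0; rewrite -subr_ge0.
apply: (@is_derive_nonneg (fun t => cos t - (1 - t ^+ 2 / 2)) (fun t => t - sin t)) => //.
- by rewrite cos0 expr0n mul0r subr0 subrr.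
- move=> t; apply: is_derive_eq; rewrite /GRing.scale /=; lra.
- by move=> t t0; rewrite subr_ge0 sin_le_id.
Qed.

Lemma sin_ge_taylor3 x : 0 <= x -> x - x ^+ 3 / 6 <= sin x.
Proof.
move=> x0; rewrite -subr_ge0.
apply: (@is_derive_nonneg (fun t => sin t - (t - t ^+ 3 / 6))
  (fun t => cos t - (1 - t ^+ 2 / 2))) => //.
- by rewrite sin0 expr0n mul0r !subr0.
- move=> t; apply: is_derive_eq; rewrite /GRing.scale /=; lra.
- by move=> t t0; rewrite subr_ge0 cos_ge_taylor2.
Qed.

Lemma cos_le_taylor4 x : 0 <= x -> cos x <= 1 - x ^+ 2 / 2 + x ^+ 4 / 24.
Proof.
move=> x0; rewrite -subr_ge0.
apply: (@is_derive_nonneg (fun t => 1 - t ^+ 2 / 2 + t ^+ 4 / 24 - cos t)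
  (fun t => sin t - (t - t ^+ 3 / 6))) => //.
- by rewrite cos0 !expr0n !mul0r subr0 addr0 subrr.
- move=> t; apply: is_derive_eq; rewrite /GRing.scale /=; lra.
- by move=> t t0; rewrite subr_ge0 sin_ge_taylor3.
Qed.

(** Since [cos (pi / 2) = 0], the bound of degree 4 is a quadratic inequality in [z = pi ^+ 2]; as
    [z <= 16], it puts [z] below the smaller root, about 10.14. *)
Lemma sqr_pi_le12 : pi ^+ 2 <= 12 :> R.
Proof.
have ph0 : 0 <= pi / 2 :> R by rewrite divr_ge0 // pi_ge0.
have := cos_le_taylor4 _ ph0; rewrite cos_pihalf.
have := @pihalf_lt2 R; have := @pi_ge2 R.
set p := pi => p2 p4.
have -> : (p / 2) ^+ 4 = (p ^+ 2) ^+ 2 / 16 by lra.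
have -> : (p / 2) ^+ 2 = p ^+ 2 / 4 by lra.
have : p ^+ 2 <= 16 by nra.
set z := p ^+ 2 => z16 h; nra.
Qed.

Lemma cos_ge_chord x : 0 <= x <= pi / 2 -> 1 - 2 * x / pi <= cos x.
Proof.
have p0 : (pi : R) != 0 by rewrite gt_eqF // pi_gt0.
move=> x0; rewrite -subr_ge0.
apply: (@concave_ge0 _ (fun t => cos t - (1 - 2 * t / pi))
  (fun t => 2 / pi - sin t) (fun t => - cos t) (pi / 2)) => //.
- move=> t; apply: is_derive_eq; rewrite /GRing.scale /=; lra.
- move=> t; apply: is_derive_eq; rewrite /GRing.scale /=; lra.
- by rewrite cos0 mulr0 mul0r subr0 subrr.
- by rewrite cos_pihalf [2 * _]mulrC divfK // divff // subrr subr0.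
- move=> t /andP[t0 tp]; rewrite oppr_le0 cos_ge0_pihalf //.
  by have := @pi_gt0 R; lra.
Qed.

(** Integrating the chord bound gives the first half of the interval; both sides are symmetric about
    [pi / 2]. *)
Lemma sin_ge_parabola x : 0 <= x <= pi -> x * (pi - x) / pi <= sin x.
Proof.
have p0 : (pi : R) != 0 by rewrite gt_eqF // pi_gt0.
have half (y : R) : 0 <= y <= pi / 2 -> y * (pi - y) / pi <= sin y.
  move=> /andP[y0 yp].
  pose F t : R := sin t - (t - t ^+ 2 / pi).
  have : F 0 <= F y.
    have dF t : is_derive t 1 F (cos t - (1 - 2 * t / pi)).
      by apply: is_derive_eq; rewrite /GRing.scale /=; lra.
    apply: (is_derive_ge0_le F _ _ _ y0 (fun t _ => dF t)).
    - exact: is_derive_within_continuous dF.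
    - by move=> t /andP[t0 ty]; rewrite subr_ge0 cos_ge_chord //; lra.
  rewrite /F sin0 expr0n mul0r !subr0 subr_ge0; congr (_ <= _).
  by rewrite mulrBr mulrBl mulfK.
move=> /andP[x0 xp]; have [xh|xh] := leP x (pi / 2); first by rewrite half ?x0.
have -> : sin x = sin (pi - x) by rewrite addrC sinDpi sinN opprK.
have := half (pi - x); rewrite subKr [_ * x]mulrC; apply; lra.
Qed.

End Trigonometric.

(** * Normalized Bernoulli polynomials *)

Section NormalizedBernoulli.
Context {R : realType}.
Implicit Types (p : {poly R}) (n k : nat) (x t c : R).

Lemma bernoulli_poly_shift n x : (0 < n)%N ->
  (bernoulli_poly n).[x + 1] = (bernoulli_poly n).[x] + n%:R * x ^+ n.-1.
Proof.
move=> n0; have [_ /(_ _ n0)[+ _]] := @bernoulli_polysP R.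
move/(congr1 (horner^~ x)) => /=.
rewrite !hornerE horner_comp !hornerE => /eqP.
by rewrite subr_eq addrC => /eqP ->; rewrite addrC.
Qed.

(** The left-hand side [C n] obeys the same derivative and difference rules as [bernoulli_poly n],
    so for positive index their difference is periodic, hence constant. Differentiating this at
    index [n.+2] makes the difference at [n.+1] zero. *)
Lemma bernoulli_poly_reflect n :
  (-1) ^+ n *: (bernoulli_poly n \Po (1 - 'X)) = bernoulli_poly n :> {poly R}.
Proof.
pose C n : {poly R} := (-1) ^+ n *: (bernoulli_poly n \Po (1 - 'X)).
have dC j : (C j.+1)^`() = j.+1%:R *: C j.
  rewrite /C derivZ deriv_comp deriv_bernoulli_poly comp_polyZ derivB derivX.
  rewrite derivC sub0r mulrN1 exprS mulN1r scaleNr scalerN opprK scalerA mulrC.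
  by rewrite -scalerA.
have cst j : exists c, C j.+1 - bernoulli_poly j.+1 = c%:P.
  exists ((C j.+1 - bernoulli_poly j.+1).[0]).
  apply: periodic_poly; apply/eqP; rewrite -subr_eq0; apply/eqP.
  have -> : (C j.+1 - bernoulli_poly j.+1) \Po ('X + 1) -
     (C j.+1 - bernoulli_poly j.+1) =
     C j.+1 \Po ('X + 1) - C j.+1 -
     (bernoulli_poly j.+1 \Po ('X + 1) - bernoulli_poly j.+1).
    by rewrite comp_polyB opprD opprK addrACA [in RHS]opprD opprK.
  have [_ /(_ j.+1 isT)[-> _]] := @bernoulli_polysP R.
  have [_ /(_ j.+1 isT)[+ _]] := @bernoulli_polysP R.
  (* Read at [- 'X], the difference equation becomes the one for [C], up to sign. *)
  move/(congr1 (comp_poly (- 'X))).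
  rewrite comp_polyB -comp_polyA comp_polyZ comp_Xn_poly exprNn.
  have -> : ('X + 1 : {poly R}) \Po - 'X = 1 - 'X.
    by rewrite comp_polyD comp_polyX -[1]/(1%:P) comp_polyC addrC.
  rewrite /C => E.
  rewrite comp_polyZ -comp_polyA.
  have -> : (1 - 'X : {poly R}) \Po ('X + 1) = - 'X.
    by rewrite comp_polyB comp_polyX -[1]/(1%:P) comp_polyC opprD addrCA subrr addr0.
  rewrite -scalerBr -(opprB (_ \Po (1 - 'X))) E exprS mulN1r scaleNr scalerN.
  rewrite opprK scalerA mulrC -scalerA -mul_polyC -[_ *: (_ * _)]mul_polyC.
  by rewrite rmorph_sign mulrA -expr2 sqrr_sign mul1r mul_polyC subrr.
case: n => [|n]; first by rewrite expr0 scale1r /= comp_polyC.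
have [c Ec] := cst n; have [d Ed] := cst n.+1.
move/(congr1 (@deriv R)): Ed.
rewrite derivB dC deriv_bernoulli_poly derivC -scalerBr Ec => /eqP.
rewrite scaler_eq0 pnatr_eq0 /= => /eqP c0.
by apply/eqP; rewrite -subr_eq0 -/(C _) Ec c0.
Qed.

Definition bern n : {poly R} := n`!%:R^-1 *: bernoulli_poly n.

Lemma deriv_bern n : (bern n.+1)^`() = bern n.
Proof.
rewrite /bern derivZ deriv_bernoulli_poly scalerA factS natrM invfM -mulrA.
by rewrite [_ * n.+1%:R]mulrC mulrA mulVf ?mul1r // pnatr_eq0.
Qed.

Lemma bern0 : bern 0 = 1.
Proof. by rewrite /bern fact0 invr1 scale1r. Qed.

Lemma bern_reflect n x : (bern n).[1 - x] = (-1) ^+ n * (bern n).[x].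
Proof.
rewrite /bern !hornerZ -[in RHS]bernoulli_poly_reflect hornerZ horner_comp.
rewrite !hornerE [X in _ = X * _ * _]mulrC -[X in _ = X * _]mulrA -expr2 sqrr_sign.
by rewrite mulr1.
Qed.

Lemma bern_at1 n : (1 < n)%N -> (bern n).[1] = (bern n).[0].
Proof.
case: n => [//|[//|n]] _; have := bernoulli_poly_shift n.+2 0 isT.
by rewrite add0r expr0n mulr0 addr0 /bern !hornerZ => ->.
Qed.

Lemma bern1_at0 : (bern 1).[0] = - 2^-1.
Proof.
have := @bernoulli_poly_shift 1 0 isT.
have := bern_reflect 1 0; rewrite /bern factS fact0 invr1 scale1r subr0 add0r expr0 expr1.
by lra.
Qed.

Lemma bern_odd_half k : (bern k.*2.+1).[2^-1] = 0.
Proof.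
have := bern_reflect k.*2.+1 2^-1.
rewrite -signr_odd /= odd_double expr1.
have -> : 1 - 2^-1 = 2^-1 :> R by lra.
by lra.
Qed.

(** Reflection makes the values at 0 and 1 opposite, while [bern_at1] makes them equal. *)
Lemma bern_odd_at0 k : (0 < k)%N -> (bern k.*2.+1).[0] = 0.
Proof.
move=> k0; have := bern_reflect k.*2.+1 0.
rewrite subr0 bern_at1; last by case: k k0.
by rewrite -signr_odd /= odd_double expr1; lra.
Qed.

End NormalizedBernoulli.

(** * Sign and size of the Bernoulli polynomials of odd index *)

Section BernoulliBounds.
Context {R : realType}.
Implicit Types (p : {poly R}) (n k : nat) (x t c : R).

Lemma poly_concave_ge0 p b x : p.[0] = 0 -> p.[b] = 0 ->
  (forall t, 0 < t < b -> p^`()^`().[t] <= 0) -> 0 <= x <= b -> 0 <= p.[x].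
Proof.
move=> p0 pb p2; apply: (@concave_ge0 _ (horner p) (horner p^`())
  (horner p^`()^`())) => // t; exact: is_derive_poly.
Qed.

(** With [m = k + 1] this is (-1)^m b_(2m-1), signed so as to be nonnegative on [[0, 1/2]]. *)
Definition sbern k : {poly R} := (-1) ^+ k.+1 *: bern k.*2.+1.

Lemma horner_sbern k t : (sbern k).[t] = (-1) ^+ k.+1 * (bern k.*2.+1).[t].
Proof. by rewrite hornerZ. Qed.

Lemma deriv2_sbern k : (sbern k.+1)^`()^`() = - sbern k.
Proof.
by rewrite /sbern doubleS derivZ deriv_bern derivZ deriv_bern exprS mulN1r scaleNr.
Qed.

Lemma sbern0 : sbern 0 = 2^-1%:P - 'X.
Proof.
have d1 : (bern 1 - 'X : {poly R})^`() = 0.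
  by rewrite derivB deriv_bern derivX bern0 subrr.
have := deriv_eq0_poly d1.
rewrite hornerD hornerN hornerX subr0 bern1_at0 => /eqP.
rewrite subr_eq => /eqP b1.
by rewrite /sbern expr1 scaleN1r b1 opprD -polyCN opprK.
Qed.

Lemma sbern0E t : (sbern 0).[t] = 2^-1 - t.
Proof. by rewrite sbern0 hornerD hornerN hornerC hornerX. Qed.

Lemma sbern_at0 k : (sbern k.+1).[0] = 0.
Proof. by rewrite horner_sbern bern_odd_at0 // mulr0. Qed.

Lemma sbern_half k : (sbern k).[2^-1] = 0.
Proof. by rewrite horner_sbern bern_odd_half mulr0. Qed.

Lemma sbern_reflect k t : (sbern k).[1 - t] = - (sbern k).[t].
Proof.
rewrite !horner_sbern bern_reflect -[X in _ * (X * _)]signr_odd /= odd_double.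
by rewrite expr1 mulN1r mulrN.
Qed.

(** Inductively, [sbern k.+1] is concave on [[0, 1/2]] and vanishes at both ends. *)
Lemma sbern_ge0 k t : 0 <= t <= 2^-1 -> 0 <= (sbern k).[t].
Proof.
elim: k t => [|k IH] t th; first by rewrite sbern0E; lra.
apply: (poly_concave_ge0 _ _ _ (sbern_at0 k) (sbern_half k.+1) _ th) => s sh.
by rewrite deriv2_sbern hornerN oppr_le0 IH //; lra.
Qed.

(* A sine majorant of [sbern 1] itself is too costly: its slope 1/12 at 0 would
   lead to the constant [2 pi^2 / 3 > 6]. Symmetrizing about 1/4 doubles the
   integral over [[0, 1/2]] and makes the term of index 0 constant, which
   yields [pi^2 / 2]. *)
Definition symsbern k : {poly R} := sbern k + (sbern k \Po (2^-1%:P - 'X)).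

(** By [sbern_reflect] the second term is minus the value of [sbern k] at [t + 1/2], so [symsbern k]
    is the s_(k+1) of the introduction. *)
Lemma horner_symsbern k t : (symsbern k).[t] = (sbern k).[t] + (sbern k).[2^-1 - t].
Proof. by rewrite /symsbern hornerD horner_comp hornerD hornerN hornerX hornerC. Qed.

Lemma deriv2_symsbern k : (symsbern k.+1)^`()^`() = - symsbern k.
Proof.
have dX : (2^-1%:P - 'X : {poly R})^`() = - 1 by rewrite derivB derivC derivX sub0r.
rewrite /symsbern derivD deriv_comp dX mulrN1 derivB deriv_comp dX mulrN1 opprK.
by rewrite deriv2_sbern raddfN opprD.
Qed.

Lemma symsbern_ends k : (symsbern k.+1).[0] = 0 /\ (symsbern k.+1).[2^-1] = 0.
Proof. by rewrite !horner_symsbern subr0 subrr sbern_at0 sbern_half addr0. Qed.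

(** As [symsbern 0] is the constant 1/2, [p] has second derivative 0 and vanishes at both ends; the
    bound is in fact an equality. *)
Lemma symsbern1_le t : 0 <= t <= 2^-1 -> (symsbern 1).[t] <= t * (2^-1 - t) / 4.
Proof.
move=> th; pose p : {poly R} := 4^-1 *: ('X * (2^-1%:P - 'X)) - symsbern 1.
have pE u : p.[u] = 4^-1 * (u * (2^-1 - u)) - (symsbern 1).[u].
  by rewrite hornerD hornerN hornerZ hornerM hornerD hornerN hornerX hornerC.
suff : 0 <= p.[t] by rewrite pE; lra.
have [s0 s1] := symsbern_ends 0.
apply: (poly_concave_ge0 _ _ _ _ _ _ th).
- by rewrite pE s0 mul0r mulr0 subrr.
- by rewrite pE s1 subrr !mulr0 subrr.
- move=> u uh; rewrite /p derivB derivB deriv2_symsbern opprK hornerD.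
  rewrite horner_symsbern !sbern0E derivZ derivZ.
  by rewrite !(derivD, derivM, derivN, derivX, derivC) !hornerE /=; lra.
Qed.

Lemma is_derive_scaled_arg (F : R -> R) (a x d : R) :
  is_derive (a * x) 1 F d -> is_derive x 1 (fun t => F (a * t)) (a * d).
Proof.
move=> dF; have da : is_derive x 1 (fun t => a * t) a.
  by apply: is_derive_eq; rewrite /GRing.scale /=; lra.
by rewrite [a * d]mulrC; exact: (is_derive1_comp dF da).
Qed.

(** The parabola bound reads [4 * pi * t * (1/2 - t) <= sin (2 * pi * t)], whence the constant
    [1 / (16 * pi)] at index 1. In the induction step the difference of the two sides vanishes at 0
    and 1/2, and its second derivative is minus the previous difference. *)
Lemma symsbern_le_sin k t : 0 <= t <= 2^-1 ->
  (symsbern k.+1).[t] <= (16 * pi)^-1 / (2 * pi) ^+ k.*2 * sin (2 * pi * t).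
Proof.
have p0 := @pi_gt0 R.
elim: k t => [|k IH] t th.
  apply: le_trans (symsbern1_le _ th) _.
  have : 0 <= 2 * pi * t <= pi by nra.
  move/sin_ge_parabola => sp.
  rewrite expr0 invr1 mulr1 [leRHS]mulrC ler_pdivlMr ?mulr_gt0 //.
  apply: le_trans sp.
  have -> : 2 * pi * t * (pi - 2 * pi * t) / pi = 2 * pi * t * (1 - 2 * t).
    rewrite -mulrA; congr (_ * _).
    by rewrite mulrBl divff ?gt_eqF // [_ * t / _]mulrAC mulfK ?gt_eqF.
  lra.
set c := (X in X * _); pose c' := (16 * pi)^-1 / (2 * pi) ^+ k.*2 : R.
have p2 : 2 * pi != 0 :> R by rewrite gt_eqF // mulr_gt0.
have cc' : c * (2 * pi) ^+ 2 = c'.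
  rewrite /c /c' doubleS -(addn2 k.*2) exprD -mulrA; congr (_ * _).
  by rewrite invfM divfK // expf_neq0.
rewrite -subr_ge0.
have [s0 s1] := symsbern_ends k.+1.
apply: (@concave_ge0 _ (fun t => c * sin (2 * pi * t) - (symsbern k.+2).[t])
  (fun t => c * (2 * pi * cos (2 * pi * t)) - (symsbern k.+2)^`().[t])
  (fun t => - (c * (2 * pi) ^+ 2 * sin (2 * pi * t)) - (symsbern k.+2)^`()^`().[t])
  2^-1) => //.
- move=> u; have ds := is_derive_scaled_arg _ _ _ _ (is_derive_sin (2 * pi * u)).
  by apply: is_derive_eq; rewrite /GRing.scale /=; lra.
- move=> u; have dc := is_derive_scaled_arg _ _ _ _ (is_derive_cos (2 * pi * u)).
  by apply: is_derive_eq; rewrite /GRing.scale /=; lra.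
- by rewrite mulr0 sin0 s0 mulr0 subrr.
- by rewrite [2 * pi]mulrC mulfK // sinpi s1 mulr0 subrr.
- move=> u uh; rewrite deriv2_symsbern hornerN opprK cc' addrC subr_le0 IH //; lra.
Qed.

Definition intsbern k : {poly R} := (-1) ^+ k.+1 *: bern k.*2.+2.

Lemma deriv_intsbern k : (intsbern k)^`() = sbern k.
Proof. by rewrite /intsbern derivZ deriv_bern. Qed.

Lemma intsbern_at1 k : (intsbern k).[1] = (intsbern k).[0].
Proof. by rewrite [LHS]hornerZ [RHS]hornerZ bern_at1. Qed.

(** The left-hand side is I_(k+1), the integral of [sbern k] over [[0, 1/2]]. *)
Lemma intsbern_increment_le k :
  (intsbern k).[2^-1] - (intsbern k).[0] <= 6 / (2 * pi) ^+ k.+1.*2.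
Proof.
have p0 := @pi_gt0 R; have p12 := @sqr_pi_le12 R.
have p2 : 2 * pi != 0 :> R by rewrite gt_eqF // mulr_gt0.
case: k => [|k].
  (* Here the increment is exactly 1/8, and the claim amounts to [pi ^+ 2 <= 12]. *)
  have d0 : (intsbern 0 + 2^-1 *: ('X ^+ 2 - 'X))^`() = 0.
    rewrite derivD deriv_intsbern sbern0 derivZ derivB derivXn derivX.
    rewrite scalerBr -scalerMnr scalerMnl -[X in X *: _ - _]mulr_natr.
    rewrite mulVf // scale1r alg_polyC.
    by rewrite addrC addrA subrK subrr.
  have iE t : (intsbern 0 + 2^-1 *: ('X ^+ 2 - 'X)).[t] =
      (intsbern 0).[t] + 2^-1 * (t ^+ 2 - t).
    by rewrite hornerD [X in _ + X]hornerZ hornerD hornerN hornerXn hornerX.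
  have := congr1 (horner^~ 2^-1) (deriv_eq0_poly d0).
  rewrite hornerC !iE -[1.*2]/2%N => h.
  have -> : (intsbern 0).[2^-1] - (intsbern 0).[0] = 8^-1 by lra.
  by rewrite ler_pdivlMr ?exprn_gt0 ?mulr_gt0 // exprMn; lra.
pose c : R := (16 * pi)^-1 / (2 * pi) ^+ k.*2.
(* A primitive of the sine majorant minus [symsbern k.+1]. Its increment over [[0, 1/2]] is [c / pi]
   minus twice the increment to be bounded. *)
pose F t := - (c / (2 * pi)) * cos (2 * pi * t) - (intsbern k.+1).[t] +
  (intsbern k.+1 \Po (2^-1%:P - 'X)).[t].
have dF t : is_derive t 1 F (c * sin (2 * pi * t) - (symsbern k.+1).[t]).
  have dc := is_derive_scaled_arg _ _ _ _ (is_derive_cos (2 * pi * t)).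
  have dr := is_derive_poly (intsbern k.+1 \Po (2^-1%:P - 'X)) t.
  have di := is_derive_poly (intsbern k.+1) t.
  apply: is_derive_eq.
  rewrite deriv_comp deriv_intsbern derivB derivC derivX sub0r mulrN1 hornerN.
  rewrite horner_comp hornerD hornerN hornerX hornerC horner_symsbern /GRing.scale /=.
  by rewrite [2 * pi * - _]mulrN mulrNN mulrA divfK //; lra.
have h0 : 0 <= 2^-1 :> R by [].
have : F 0 <= F 2^-1.
  apply: (is_derive_ge0_le F _ _ _ h0 (fun t _ => dF t)).
    exact: is_derive_within_continuous dF.
  by move=> t th; rewrite subr_ge0 symsbern_le_sin //; lra.
rewrite /F !horner_comp !hornerD !hornerN !hornerX !hornerC mulr0 cos0.
rewrite [2 * pi]mulrC mulfK // cospi subr0 subrr [pi * 2]mulrC => h.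
have cE : c / (2 * pi) = pi ^+ 2 / 2 / (2 * pi) ^+ k.+2.*2.
  have fE (q v : R) : q != 0 -> v != 0 ->
      (16 * q)^-1 / v / (2 * q) = q ^+ 2 / 2 / (v * (2 * q) ^+ 4).
    by move=> q0 v0; field; rewrite q0.
  by rewrite !doubleS -(addn4 k.*2) exprD fE ?gt_eqF // exprn_gt0 // mulr_gt0.
apply: (@le_trans _ _ (c / (2 * pi))); first by lra.
rewrite cE ler_pM2r ?invr_gt0 ?exprn_gt0 ?mulr_gt0 //; lra.
Qed.

End BernoulliBounds.

(** * Euler-Maclaurin expansion on one panel *)

Section EulerMaclaurin.
Context {R : realType}.
Implicit Types (F f g w Q H : R -> R) (D : nat -> R -> R) (a b c d x t : R).

Lemma within_continuousM (S : set R) f g : {within S, continuous f} ->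
  {within S, continuous g} -> {within S, continuous (fun x => f x * g x)}.
Proof. by move=> cf cg x; apply: cvgM; [exact: cf|exact: cg]. Qed.

Lemma within_continuous_cst (S : set R) c : {within S, continuous (fun=> c)}.
Proof. by move=> x; exact: cst_continuous. Qed.

(** Replacing [g] by [g c] on both sides of [c] lowers the increment of [H], and [Q b = Q a] makes
    the result 0. Replacing it by [g a] before [c] and by [g b] after raises the increment to the
    upper bound. *)
Lemma weighted_increment_bounds Q w H g a b c : a <= c -> c <= b ->
  (forall t, is_derive t 1 Q (w t)) ->
  (forall t, a < t < b -> is_derive t 1 H (w t * g t)) ->
  {within `[a, b], continuous H} ->
  (forall t, a <= t <= c -> 0 <= w t) -> (forall t, c <= t <= b -> w t <= 0) ->
  (forall x y, a <= x -> x <= y -> y <= b -> g y <= g x) -> Q b = Q a ->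
  0 <= H b - H a <= (Q c - Q a) * (g a - g b).
Proof.
move=> ac cb dQ dH cH w0 w1 gd Qab.
(* Compares the increments of [H] and [l * Q]: from below for [s = 1], from above for [s = -1]. *)
have cmp (s l x y : R) : a <= x -> x <= y -> y <= b ->
    (forall t, x < t < y -> 0 <= s * (w t * (g t - l))) ->
    0 <= s * ((H y - H x) - l * (Q y - Q x)).
  move=> ax xy yb sl.
  pose F t := s * (H t - l * Q t).
  suff : F x <= F y by rewrite /F; lra.
  apply: (@is_derive_ge0_le _ F (fun t => s * (w t * (g t - l)))) => //.
    move=> t /andP[xt ty].
    have tab : a < t < b by rewrite (le_lt_trans ax xt) (lt_le_trans ty yb).
    have dHt := dH t tab.
    by rewrite /F; apply: is_derive_eq; rewrite /GRing.scale /=; lra.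
  have cHxy : {within `[x, y], continuous H}.
    by apply: continuous_subspaceW cH; apply: subset_itv; rewrite bnd_simp.
  have cQxy := is_derive_within_continuous Q w `[x, y]%classic dQ.
  apply: within_continuousM; first exact: within_continuous_cst.
  apply: within_continuousB => //.
  by apply: within_continuousM => //; exact: within_continuous_cst.
have h1 := cmp 1 (g c) a c (lexx a) ac cb.
have h2 := cmp (- 1) (g a) a c (lexx a) ac cb.
have h3 := cmp 1 (g c) c b ac cb (lexx b).
have h4 := cmp (- 1) (g b) c b ac cb (lexx b).
have {}h1 : 0 <= 1 * ((H c - H a) - g c * (Q c - Q a)).
  apply: h1 => t /andP[at_ tc]; rewrite mul1r mulr_ge0 ?subr_ge0 ?gd ?w0 //; lra.
have {}h2 : 0 <= (- 1) * ((H c - H a) - g a * (Q c - Q a)).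
  apply: h2 => t /andP[at_ tc]; rewrite mulN1r -mulrN opprB mulr_ge0 ?subr_ge0 ?gd ?w0 //; lra.
have {}h3 : 0 <= 1 * ((H b - H c) - g c * (Q b - Q c)).
  apply: h3 => t /andP[ct tb].
  rewrite mul1r -mulrNN opprB mulr_ge0 ?subr_ge0 ?oppr_ge0 ?gd ?w1 //; lra.
have {}h4 : 0 <= (- 1) * ((H b - H c) - g b * (Q b - Q c)).
  apply: h4 => t /andP[ct tb].
  rewrite mulN1r -mulNr mulr_ge0 ?subr_ge0 ?oppr_ge0 ?gd ?w1 //; lra.
by rewrite Qab in h3 h4; apply/andP; split; lra.
Qed.

(** The factor [d ^+ n] absorbs the chain rule, so each of these polynomials is again the derivative
    of the next. *)
Definition scaled_bern a d n : {poly R} :=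
  d ^+ n *: (bern n \Po (d^-1 *: ('X - a%:P))).

Lemma horner_scaled_bern a d n t :
  (scaled_bern a d n).[t] = d ^+ n * (bern n).[(t - a) / d].
Proof.
rewrite hornerZ horner_comp; congr (_ * (bern n).[_]).
by rewrite hornerZ hornerD hornerN hornerX hornerC mulrC.
Qed.

Lemma deriv_scaled_bern a d n : d != 0 ->
  (scaled_bern a d n.+1)^`() = scaled_bern a d n.
Proof.
move=> d0; rewrite derivZ deriv_comp deriv_bern derivZ derivB derivX derivC.
by rewrite subr0 alg_polyC mulrC mul_polyC scalerA exprSr mulfK.
Qed.

(** The function W of the introduction, [D j] standing for the j-th derivative of f. *)
Definition bern_primitive D a d n t : R :=
  \sum_(j < n) (-1) ^+ j * ((scaled_bern a d j.+1).[t] * D j t).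

Lemma bern_primitiveS D a d n t : bern_primitive D a d n.+1 t =
  bern_primitive D a d n t + (-1) ^+ n * ((scaled_bern a d n.+1).[t] * D n t).
Proof. by rewrite /bern_primitive big_ord_recr. Qed.

(** The product rule gives two parts per term; the second cancels against the first part of the next
    term. *)
Lemma is_derive_bern_primitive D a d n t : d != 0 ->
  (forall j, (j < n)%N -> is_derive t 1 (D j) (D j.+1 t)) ->
  is_derive t 1 (bern_primitive D a d n)
    (D 0 t - (-1) ^+ n * ((scaled_bern a d n).[t] * D n t)).
Proof.
move=> d0; elim: n => [|n IH] dD.
  have -> : bern_primitive D a d 0 = cst 0.
    by apply/funext => x; rewrite /bern_primitive big_ord0.
  rewrite horner_scaled_bern bern0 hornerC !expr0 !mul1r subrr.
  exact: is_derive_cst.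
have -> : bern_primitive D a d n.+1 = fun x => bern_primitive D a d n x +
    (-1) ^+ n * ((scaled_bern a d n.+1).[x] * D n x).
  by apply/funext => x; rewrite bern_primitiveS.
have dI := IH (fun j jn => dD j (ltnW jn)).
have dn := dD n (ltnSn n).
have dq := is_derive_poly (scaled_bern a d n.+1) t.
rewrite deriv_scaled_bern // in dq.
by apply: is_derive_eq; rewrite /GRing.scale /= exprS; lra.
Qed.

Lemma continuous_bern_primitive D a d n (S : set R) :
  (forall j, (j < n)%N -> {within S, continuous (D j)}) ->
  {within S, continuous (bern_primitive D a d n)}.
Proof.
elim: n => [|n IH] cD.
  have -> : bern_primitive D a d 0 = cst 0.
    by apply/funext => x; rewrite /bern_primitive big_ord0.
  exact: within_continuous_cst.
have -> : bern_primitive D a d n.+1 = fun x => bern_primitive D a d n x +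
    (-1) ^+ n * ((scaled_bern a d n.+1).[x] * D n x).
  by apply/funext => x; rewrite bern_primitiveS.
have cI := IH (fun j jn => cD j (ltnW jn)).
have cn := cD n (ltnSn n).
have cq := is_derive_within_continuous _ _ S (is_derive_poly (scaled_bern a d n.+1)).
apply: within_continuousD => //.
apply: within_continuousM; first exact: within_continuous_cst.
exact: within_continuousM.
Qed.

(** The values -1/2 and 1/2 of b_1 at the ends give the trapezoid. From index 2 on the two end
    values agree, and they vanish at odd indices. *)
Lemma bern_primitive_increment D a d k : d != 0 ->
  bern_primitive D a d k.*2.+1 (a + d) - bern_primitive D a d k.*2.+1 a =
  d / 2 * (D 0%N a + D 0%N (a + d)) -
  \sum_(1 <= i < k.+1) d ^+ i.*2 * (bern i.*2).[0] *
    (D i.*2.-1 (a + d) - D i.*2.-1 a).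
Proof.
move=> d0; have h1 : (a + d - a) / d = 1 by rewrite addrC addKr divff.
have h0 : (a - a) / d = 0 by rewrite subrr mul0r.
elim: k => [|k IH].
  rewrite big_geq // subr0 /bern_primitive !big_ord1 !horner_scaled_bern h1 h0.
  have := @bern_reflect R 1 0; rewrite subr0 bern1_at0 => ->; rewrite !expr1; lra.
rewrite doubleS 2!bern_primitiveS [bern_primitive _ _ _ k.*2.+3 a]bern_primitiveS.
rewrite [bern_primitive _ _ _ k.*2.+2 a]bern_primitiveS big_nat_recr //=.
rewrite !horner_scaled_bern h1 h0 -!doubleS !bern_at1 // bern_odd_at0 //.
have -> : (-1) ^+ k.*2.+1 = -1 :> R by rewrite -signr_odd /= odd_double.
by rewrite doubleS /=; lra.
Qed.

End EulerMaclaurin.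

(** * Remainder of one panel, and summation over the panels *)

Section Panels.
Context {R : realType}.
Implicit Types (f g A : R -> R) (D : nat -> R -> R) (a b d x t : R).

Lemma panel_remainder_bounds D A a d k : 0 < d ->
  (forall j, (j <= k.*2)%N -> {within `[a, a + d], continuous (D j)}) ->
  (forall j t, (j <= k.*2)%N -> a < t < a + d -> is_derive t 1 (D j) (D j.+1 t)) ->
  (forall x y, a <= x -> x <= y -> y <= a + d -> D k.*2.+1 y <= D k.*2.+1 x) ->
  {within `[a, a + d], continuous A} ->
  (forall t, a < t < a + d -> is_derive t 1 A (D 0%N t)) ->
  0 <= (-1) ^+ k.+1 *
       ((bern_primitive D a d k.*2.+1 (a + d) - bern_primitive D a d k.*2.+1 a)
        - (A (a + d) - A a))
    <= d ^+ k.+1.*2 * (6 / (2 * pi) ^+ k.+1.*2) * (D k.*2.+1 a - D k.*2.+1 (a + d)).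
Proof.
move=> d0 cD dD decr cA dA.
have dn0 : d != 0 by rewrite gt_eqF.
pose W := bern_primitive D a d k.*2.+1.
(* The derivative of [H] is Q' times [D k.*2.+1], where Q' is nonnegative before the midpoint of the
   panel and nonpositive after it. *)
pose H t := (-1) ^+ k.+1 * (W t - A t).
pose Q : {poly R} := (-1) ^+ k.+1 *: scaled_bern a d k.*2.+2.
have QE t : Q.[t] = d ^+ k.+1.*2 * (intsbern k).[(t - a) / d].
  by rewrite hornerZ horner_scaled_bern mulrCA; congr (_ * _); rewrite -hornerZ.
have wE t : (Q^`()).[t] = d ^+ k.*2.+1 * (sbern k).[(t - a) / d].
  rewrite derivZ deriv_scaled_bern // hornerZ horner_scaled_bern mulrCA horner_sbern.
  by [].
have da x : a <= x -> 0 <= (x - a) / d.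
  by move=> ax; rewrite divr_ge0 ?subr_ge0 // ltW.
have bnd : 0 <= H (a + d) - H a <=
    (Q.[a + d / 2] - Q.[a]) * (D k.*2.+1 a - D k.*2.+1 (a + d)).
  apply: (@weighted_increment_bounds _ (horner Q) (horner Q^`())) => //.
  - lra.
  - lra.
  - move=> t tI.
    have dW : is_derive t 1 W (D 0%N t - (-1) ^+ k.*2.+1 *
        ((scaled_bern a d k.*2.+1).[t] * D k.*2.+1 t)).
      by apply: is_derive_bern_primitive => // j jk; exact: dD.
    have dAt := dA t tI.
    have -> : Q^`().[t] * D k.*2.+1 t = (-1) ^+ k.+1 *
        ((D 0%N t - (-1) ^+ k.*2.+1 *
        ((scaled_bern a d k.*2.+1).[t] * D k.*2.+1 t)) - D 0%N t).
      rewrite derivZ deriv_scaled_bern // hornerZ.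
      have -> : (-1) ^+ k.*2.+1 = -1 :> R by rewrite -signr_odd /= odd_double.
      by lra.
    by rewrite /H; apply: is_derive_eq; rewrite /GRing.scale /=; lra.
  - apply: within_continuousM; first exact: within_continuous_cst.
    apply: within_continuousB => //.
    by apply: continuous_bern_primitive => j jk; exact: cD.
  - move=> t tI; rewrite wE mulr_ge0 ?exprn_ge0 ?(ltW d0) // sbern_ge0 //.
    by rewrite da ?ler_pdivrMr //; lra.
  - move=> t tI; rewrite wE mulr_ge0_le0 ?exprn_ge0 ?(ltW d0) //.
    (* The second half of the panel reduces to the first by antisymmetry about 1/2. *)
    rewrite -[(t - a) / d](subKr 1) sbern_reflect oppr_le0 sbern_ge0 //.
    have : (t - a) / d <= 1 by rewrite ler_pdivrMr //; lra.
    have : 2^-1 <= (t - a) / d by rewrite ler_pdivlMr //; lra.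
    by lra.
  - by rewrite !QE addrC addKr divff // subrr mul0r intsbern_at1.
have <- : H (a + d) - H a = (-1) ^+ k.+1 * ((W (a + d) - W a) - (A (a + d) - A a)).
  by rewrite /H; lra.
have /andP[b0 b1] := bnd; rewrite b0 /=; apply: le_trans b1 _.
apply: ler_wpM2r; first by rewrite subr_ge0 decr //; lra.
rewrite !QE -mulrBr ler_wpM2l ?exprn_ge0 ?(ltW d0) //.
rewrite subrr mul0r [a + _]addrC addrK mulrAC divff // mul1r.
exact: intsbern_increment_le.
Qed.

Lemma Rintegral_primitive f : {within `[0, 1], continuous f} ->
  exists A, [/\ {within `[0, 1], continuous A},
    (forall t, 0 < t < 1 -> is_derive t 1 A (f t)) &
    \int[lebesgue_measure]_(t in `[0, 1]) f t = A 1 - A 0].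
Proof.
move=> cf; exists (fun x => \int[lebesgue_measure]_(t in `[0, x]) f t).
have fi : lebesgue_measure.-integrable `[0, 1] (EFin \o f).
  by apply: continuous_compact_integrable => //; exact: segment_compact.
split.
- exact: parameterized_integral_continuous.
- move=> t /andP[t0 t1].
  have ft : {for t, continuous f}.
    by apply: (within_continuous_continuous (@ltr01 R) cf); rewrite in_itv /= t0.
  have [dF EF] := continuous_FTC1_closed t1 fi t0 ft.
  by rewrite -EF derive1E; exact/derivableP.
- by rewrite set_itv1 Rintegral_set1 subr0.
Qed.

Lemma panel_telescope p g : (0 < p)%N ->
  \sum_(i < p) (g (i%:R / p%:R + p%:R^-1) - g (i%:R / p%:R)) = g 1 - g 0.
Proof.
move=> p0; have pn0 : p%:R != 0 :> R by rewrite pnatr_eq0 -lt0n.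
have := @telescope_sumr R 0 p (fun i => g (i%:R / p%:R)) (leq0n p).
rewrite big_mkord mul0r divff // => <-.
by apply: eq_bigr => i _; rewrite -[i.+1]addn1 natrD mulrDl mul1r.
Qed.

Lemma trapezoid_panels p f : (0 < p)%N ->
  \sum_(i < p) p%:R^-1 / 2 * (f (i%:R / p%:R) + f (i%:R / p%:R + p%:R^-1)) =
  trapezoid p f.
Proof.
case: p => // p _; set q : R := p.+1%:R.
have q0 : q != 0 by rewrite pnatr_eq0.
pose u i := f (i%:R / q).
have uS (i : nat) : f (i%:R / q + q^-1) = u i.+1.
  by rewrite /u -[i.+1]addn1 natrD mulrDl mul1r.
rewrite (eq_bigr (fun i : 'I_p.+1 => q^-1 / 2 * (u i + u i.+1))); last first.
  by move=> i _; rewrite uS.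
have -> : trapezoid p.+1 f = (u 0%N + u p.+1) / (2 * q) + q^-1 * \sum_(1 <= i < p.+1) u i.
  by rewrite /trapezoid /u mul0r divff.
rewrite -mulr_sumr invfM.
suff -> : \sum_(i < p.+1) (u i + u i.+1) = u 0%N + u p.+1 + 2 * \sum_(1 <= i < p.+1) u i.
  by field.
(* The nodes depend on the number of panels, so the induction is on an arbitrary sequence [u]. *)
elim: p {q q0 u uS} (u) => [|p IH] u.
  by rewrite big_ord1 big_geq // mulr0 addr0.
by rewrite big_ord_recr IH [in RHS]big_nat_recr //=; lra.
Qed.

Lemma bern_primitive_panels D p k : (0 < p)%N ->
  \sum_(i < p) (bern_primitive D (i%:R / p%:R) p%:R^-1 k.*2.+1 (i%:R / p%:R + p%:R^-1)
    - bern_primitive D (i%:R / p%:R) p%:R^-1 k.*2.+1 (i%:R / p%:R)) =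
  trapezoid p (D 0%N) - \sum_(1 <= j < k.+1) p%:R^-1 ^+ j.*2 * (bern j.*2).[0] *
    (D j.*2.-1 1 - D j.*2.-1 0).
Proof.
move=> p0; have pn0 : p%:R^-1 != 0 :> R by rewrite invr_eq0 pnatr_eq0 -lt0n.
under eq_bigr do rewrite bern_primitive_increment //.
rewrite sumrB trapezoid_panels // exchange_big; congr (_ - _).
by apply: eq_bigr => j _; rewrite -mulr_sumr panel_telescope.
Qed.

End Panels.

Theorem proposition9p1 (R : realType) (B : nat -> {poly R})
    (hB : bernoulli_polys B) (m : nat) (hm : (0 < m)%N) (f : R -> R)
    (hf : continuous_nth_derive_on `[0, 1] (2 * m - 1) f)
    (hdecr : forall x y : R, 0 <= x -> x <= y -> y <= 1 ->
       derive_on_n `[0, 1] (2 * m - 1) f y <= derive_on_n `[0, 1] (2 * m - 1) f x)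
    (p : nat) (hp : (0 < p)%N) :
  exists Rmp : R,
    \int[lebesgue_measure]_(t in `[0, 1]) f t =
      trapezoid p f
      - \sum_(1 <= k < m)
          (B (2 * k)%N).[0] / ((2 * k)`!%:R * p%:R ^+ (2 * k)) *
          (derive_on_n `[0, 1] (2 * k - 1) f 1
           - derive_on_n `[0, 1] (2 * k - 1) f 0)
      + (-1) ^+ m.+1 * Rmp
    /\ 0 <= Rmp
    /\ Rmp <= 6 / (2 * pi * p%:R) ^+ (2 * m) *
              (derive_on_n `[0, 1] (2 * m - 1) f 0
               - derive_on_n `[0, 1] (2 * m - 1) f 1).
Proof.
case: m hm hf hdecr => [//|k] _.
have -> : (2 * k.+1 - 1 = k.*2.+1)%N by rewrite mul2n doubleS subn1.
move=> [hf _]; pose D j := derive_on_n `[0, 1] j f; rewrite -/(D _) => hdecr.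
have cD j : (j <= k.*2)%N -> {within `[0, 1], continuous (D j)}.
  by move=> jk; apply: derivable_on_continuous => x; exact: hf.
have dD j (t : R) : (j <= k.*2)%N -> 0 < t < 1 -> is_derive t 1 (D j) (D j.+1 t).
  move=> jk t01; apply: (derivable_on_is_derive _ _ _ _ t01); apply: hf => //.
  by rewrite /= in_itv /=; case/andP: t01 => /ltW -> /ltW ->.
have [A [cA dA ->]] := Rintegral_primitive f (cD 0%N isT).
have p0 : 0 < p%:R :> R by rewrite ltr0n.
have d0 : 0 < p%:R^-1 :> R by rewrite invr_gt0.
pose a (i : 'I_p) : R := i%:R / p%:R.
pose W i := bern_primitive D (a i) p%:R^-1 k.*2.+1.
(* The signed error on panel [i]; the sum of these is the required remainder. *)
pose r i := (-1) ^+ k.+1 * ((W i (a i + p%:R^-1) - W i (a i)) -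
  (A (a i + p%:R^-1) - A (a i))).
have rP i : 0 <= r i <= p%:R^-1 ^+ k.+1.*2 * (6 / (2 * pi) ^+ k.+1.*2) *
    (D k.*2.+1 (a i) - D k.*2.+1 (a i + p%:R^-1)).
  have a0 : 0 <= a i by rewrite divr_ge0.
  have a1 : a i + p%:R^-1 <= 1.
    by rewrite -[X in _ + X]mul1r -mulrDl ler_pdivrMr // mul1r natr1 ler_nat.
  have sub : `[a i, a i + p%:R^-1] `<=` `[0, 1].
    by apply: subset_itv; rewrite bnd_simp.
  apply: panel_remainder_bounds => //.
  - by move=> j jk; exact: continuous_subspaceW sub (cD j jk).
  - by move=> j t jk tI; apply: dD => //; lra.
  - by move=> x y ax xy ya; apply: hdecr => //; lra.
  - exact: continuous_subspaceW sub cA.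
  - by move=> t tI; apply: dA; lra.
exists (\sum_i r i); split; [|split].
- rewrite -mulr_sumr sumrB panel_telescope // bern_primitive_panels //.
  have -> : \sum_(1 <= j < k.+1) (B (2 * j)%N).[0] / ((2 * j)`!%:R * p%:R ^+ (2 * j)) *
        (derive_on_n `[0, 1] (2 * j - 1) f 1 - derive_on_n `[0, 1] (2 * j - 1) f 0) =
      \sum_(1 <= j < k.+1) p%:R^-1 ^+ j.*2 * (bern j.*2).[0] *
        (D j.*2.-1 1 - D j.*2.-1 0).
    apply: eq_big_nat => j _.
    (* Uniqueness replaces [B] by the constructed polynomials; the factorial is the normalization in
       [bern]. *)
    rewrite (bernoulli_polys_unique hB) -subn1 mul2n hornerZ exprVn invfM.
    by congr (_ * _); rewrite mulrA [RHS]mulrC [X in _ = X * _]mulrC.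
  (* With [m = k + 1] the two signs multiply to -1, so the expansion cancels and the integral
     remains. *)
  rewrite mulrA exprS -[_ * _ * (-1) ^+ _]mulrA -expr2 sqrr_sign mulr1 mulN1r.
  by rewrite opprB [RHS]addrC subrK.
- by apply: sumr_ge0 => i _; case/andP: (rP i).
- apply: (@le_trans _ _ (\sum_i p%:R^-1 ^+ k.+1.*2 * (6 / (2 * pi) ^+ k.+1.*2) *
    (D k.*2.+1 (a i) - D k.*2.+1 (a i + p%:R^-1)))).
    by apply: ler_sum => i _; case/andP: (rP i).
  rewrite -mulr_sumr le_eqVlt; apply/orP; left; apply/eqP.
  have coefE (u v : R) n : v^-1 ^+ n * (6 / u ^+ n) = 6 / (u * v) ^+ n.
    by rewrite -!exprVn invfM exprMn mulrCA [X in 6 * X]mulrC.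
  rewrite mul2n coefE; congr (_ * _).
  apply: oppr_inj; rewrite -sumrN opprB -(panel_telescope p) //.
  by apply: eq_bigr => i _; rewrite opprB.
Qed.
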